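(* Let $G$ be a simple connected graph of order $n$, let $uv\in E(G)$, and let $G'=G-uv+uw+wv$ be the graph obtained by inserting a new vertex $w$ into the edge $uv$. Then $\lambda_{2}(G)\geq\lambda_{2}(G')$. Moreover, if $f$ is a harmonic eigenfunction associated with $\lambda_{2}(G)$ with $f(u)f(v)\neq 0$, then $\lambda_{2}(G)>\lambda_{2}(G')$.
   Context: For a simple graph $G$, $A$ is its adjacency matrix, $D$ the diagonal matrix of vertex degrees $d(x)$, $L=D-A$ its Laplacian and $\mathcal{L}(G)=D^{-1/2}LD^{-1/2}$ its normalized Laplacian, with eigenvalues $0=\lambda_1(G)\le\lambda_2(G)\le\cdots\le\lambda_n(G)$. Functions $f:V(G)\to\mathbb{R}$ are viewed as vectors; $e$ is the all-ones vector and $f\perp De$ means $\sum_x d(x)f(x)=0$. With $R(f)=\frac{\sum_{xy\in E(G)}(f(x)-f(y))^2}{\sum_{x}d(x)f(x)^2}$, one has $\lambda_2(G)=\inf_{f\neq0,\,f\perp De}R(f)$; a harmonic eigenfunction associated with $\lambda_2(G)$ is a nonzero $f\perp De$ with $R(f)=\lambda_2(G)$. *)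

(* Defs.v *)
From mathcomp Require Import all_boot all_order all_algebra.
From mathcomp Require Import polyrcf.

Set Implicit Arguments.
Unset Strict Implicit.
Unset Printing Implicit Defensive.

Import Order.TTheory GRing.Theory Num.Theory.
Local Open Scope ring_scope.

(* A finite simple graph is a symmetric irreflexive relation on a finType. *)

Definition connected_graph (T : finType) (e : rel T) : Prop :=
  forall x y : T, connect e x y.

Definition deg (T : finType) (e : rel T) (x : T) : nat := #|[set y | e x y]|.

(* None is the inserted vertex w. *)
Definition subdivide (T : finType) (e : rel T) (u v : T) : rel (option T) :=
  fun x y =>
    match x, y with
    | Some a, Some b => e a b && ([set a; b] != [set u; v])
    | Some a, None | None, Some a => a \in [set u; v]
    | None, None => false
    end.

Lemma subdivide_sym (T : finType) (e : rel T) (u v : T) :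
  symmetric e -> symmetric (subdivide e u v).
Proof. by move=> e_sym [x|] [y|] //=; rewrite e_sym setUC. Qed.

Lemma subdivide_irr (T : finType) (e : rel T) (u v : T) :
  irreflexive e -> irreflexive (subdivide e u v).
Proof. by move=> e_irr [x|] //=; rewrite e_irr. Qed.

Section NormalizedLaplacian.
Variables (R : rcfType) (T : finType) (e : rel T).

(* Rows and columns are indexed by vertices through enum_val. *)
Definition adj_mx : 'M[R]_#|T| :=
  \matrix_(i, j) (e (enum_val i) (enum_val j))%:R.

Definition deg_mx : 'M[R]_#|T| :=
  diag_mx (\row_i (deg e (enum_val i))%:R).

Definition lapl_mx : 'M[R]_#|T| := deg_mx - adj_mx.

(* D^(-1/2); since 0^-1 = 0, an isolated vertex gets the entry 0. *)
Definition deg_isqrt_mx : 'M[R]_#|T| :=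
  diag_mx (\row_i (Num.sqrt (deg e (enum_val i))%:R)^-1).

Definition normalized_lapl_mx : 'M[R]_#|T| :=
  deg_isqrt_mx *m lapl_mx *m deg_isqrt_mx.

End NormalizedLaplacian.

(* The real eigenvalues in nondecreasing order, each repeated according to its
   algebraic multiplicity: rootsR lists the distinct real roots increasingly. *)
Definition eigenvalues (R : rcfType) (n : nat) (A : 'M[R]_n) : seq R :=
  flatten [seq nseq (mup a (char_poly A)) a | a <- rootsR (char_poly A)].

Lemma eigenvalues_eq (R : rcfType) (n : nat) (A : 'M[R]_n) (s : seq R) :
  sorted <=%R s -> char_poly A = \prod_(a <- s) ('X - a%:P) ->
  eigenvalues A = s.
Proof.
move=> s_sorted pE; rewrite /eigenvalues.
have p0 : char_poly A != 0 by apply: monic_neq0; apply: char_poly_monic.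
have mupE a : mup a (char_poly A) = count_mem a s.
  by rewrite pE mu_prod_XsubC.
have rE a : (a \in rootsR (char_poly A)) = root (char_poly A) a.
  by rewrite -(roots_on_rootsR p0) in_itv.
set r := rootsR _ in rE *.
have r_sorted : sorted <%R r by apply: sorted_roots.
have r_uniq : uniq r := lt_sorted_uniq r_sorted.
apply: (sorted_eq le_trans le_anti) => //.
  elim: r r_sorted {rE r_uniq} => //= a r IHr a_r.
  rewrite sorted_pairwise; last exact: le_trans.
  rewrite pairwise_cat -!sorted_pairwise; try exact: le_trans.
  rewrite IHr ?(path_sorted a_r) // andbT; apply/andP; split.
    apply/allrelP => x y /nseqP[-> _] /flattenP[_ /mapP[b br ->]] /nseqP[-> _].
    by apply: ltW; have /allP := order_path_min lt_trans a_r; apply.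
  by elim: (mup a _) => //= [[|m]] //= ->; rewrite lexx.
apply/allP => x _ /=; apply/eqP.
rewrite count_flatten -map_comp -(mupE x).
have -> : sumn [seq (count_mem x \o (fun a => nseq (mup a (char_poly A)) a)) a
    | a <- r] = (\sum_(a <- r) (a == x) * mup a (char_poly A))%N.
  rewrite sumnE big_map; apply: eq_bigr => a _ /=.
  by rewrite count_nseq.
have [rx|rx] := boolP (x \in r).
  rewrite (bigD1_seq x) //= eqxx mul1n big1 ?addn0 // => a /negPf ->.
  by rewrite mul0n.
rewrite mupNroot -?rE // big_seq big1 // => a ar.
by case: eqP => // ax; rewrite -ax ar in rx.
Qed.

(* 1-based, as in lambda_1 <= lambda_2 <= ... <= lambda_n. *)
Definition lambda (R : rcfType) (T : finType) (e : rel T) (k : nat) : R :=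
  nth 0 (eigenvalues (normalized_lapl_mx R e)) k.-1.

(* The double sum counts each edge in both directions, hence the 2^-1. *)
Definition rayleigh (R : rcfType) (T : finType) (e : rel T) (f : T -> R) : R :=
  (2^-1 * \sum_x \sum_(y | e x y) (f x - f y) ^+ 2)
  / \sum_x (deg e x)%:R * f x ^+ 2.

Definition harmonic_eigenfunction
    (R : rcfType) (T : finType) (e : rel T) (f : T -> R) : Prop :=
  [/\ exists x, f x != 0,
      \sum_x (deg e x)%:R * f x = 0
    & rayleigh e f = lambda R e 2].

(* Main.v *)
(* Extend a function f orthogonal to De by a value t at the new vertex w and
   subtract its weighted mean. The unnormalized energy changes by
   2(t - f(u))(t - f(v)) and the weighted norm increases by
   2t^2 vol/(vol + 2), so a suitable t does not increase the Rayleigh quotient,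
   and decreases it strictly when f(u)f(v) <> 0.
   The variational description of lambda_2 comes from the complex spectral
   theorem over R[i]: in a complex two-dimensional family one picks a vector
   killed by one linear condition, and its real or imaginary part satisfies the
   desired inequality because a real symmetric form splits over the two. *)
Require Import Defs.
From mathcomp Require Import all_boot all_order all_algebra.
From mathcomp Require Import complex reals ring lra.

Set Implicit Arguments.
Unset Strict Implicit.
Unset Printing Implicit Defensive.

Import Order.TTheory GRing.Theory Num.Theory.
Local Open Scope ring_scope.

(** * The second eigenvalue of a real symmetric matrix *)

Section SymmetricMatrices.
Import sesquilinear.
Local Open Scope complex_scope.
Local Open Scope sesquilinear_scope.

Lemma char_poly_conj (K : comUnitRingType) (n : nat) (P A : 'M[K]_n) :
  P \in unitmx -> char_poly (invmx P *m A *m P) = char_poly A.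
Proof.
move=> P_unit; have PV : map_mx polyC (invmx P) *m map_mx polyC P = 1%:M.
  by rewrite -map_mxM mulVmx // map_mx1.
rewrite /char_poly /char_poly_mx !map_mxM.
have {1}-> : 'X%:M = map_mx polyC (invmx P) *m 'X%:M *m map_mx polyC P.
  by rewrite scalar_mxC -mulmxA PV mulmx1.
by rewrite -mulmxBl -mulmxBr !det_mulmx mulrAC -det_mulmx PV det1 mul1r.
Qed.

(** The complexification of [A] is Hermitian, so it is unitarily diagonalizable with a real
    diagonal; hence the characteristic polynomial splits over [R], and its sorted roots form
    [eigenvalues A]. *)
Lemma symmetric_spectral (R : rcfType) (n : nat) (A : 'M[R]_n) :
  A^T = A ->
  exists (P : 'M[R[i]]_n) (d : 'rV[R]_n),
    [/\ P \is unitarymx,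
        map_mx (real_complex R) A =
          P^t* *m diag_mx (map_mx (real_complex R) d) *m P
      & eigenvalues A = sort <=%R [seq d 0 i | i <- enum 'I_n]].
Proof.
move=> A_sym; set AC := map_mx _ A.
have AC_real : AC \is a mxOver Num.real.
  by apply/mxOverP => i j; rewrite mxE; apply/complex_realP; exists (A i j).
have AC_sym : AC \is symmetricmx.
  by apply/is_hermitianmxP; rewrite expr0 scale1r map_mx_id // map_trmx A_sym.
have AC_herm := realsym_hermsym AC_sym AC_real.
have /orthomx_spectralP ACE := symmetric_normalmx AC_sym AC_real.
set P := spectralmx AC in ACE; set D := spectral_diag AC in ACE.
have PU : P \is unitarymx := spectral_unitarymx AC.
pose d := map_mx (@complex.Re R) D.
have DE : D = map_mx (real_complex R) d.
  apply/rowP => i; rewrite !mxE RRe_real //.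
  by have /mxOverP := hermitian_spectral_diag_real AC_herm; apply.
exists P, d; split=> //; first by rewrite -DE -invmx_unitary.
apply: eigenvalues_eq; first exact/sort_sorted/le_total.
(* The diagonalization lives over [R[i]], so the factorization is checked there. *)
apply: (map_poly_inj (real_complex R)).
rewrite map_char_poly -/AC ACE.
rewrite char_poly_conj ?spectral_unit // char_poly_trig ?diag_mx_is_trig //.
rewrite [RHS]rmorph_prod /= (perm_big _ (permEl (perm_sort _ _))) big_map big_enum.
apply: eq_bigr => i _; rewrite !mxE eqxx mulr1n rmorphB /= map_polyX map_polyC /=.
by rewrite {1}DE !mxE.
Qed.

Lemma two_least_eigenvalues (R : rcfType) (n : nat) (A : 'M[R]_n) :
  A^T = A -> (1 < n)%N ->
  exists (P : 'M[R[i]]_n) (d : 'rV[R]_n) (i1 i2 : 'I_n),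
    [/\ P \is unitarymx,
        map_mx (real_complex R) A =
          P^t* *m diag_mx (map_mx (real_complex R) d) *m P,
        d 0 i2 = nth 0 (eigenvalues A) 1
      & [/\ i1 != i2, d 0 i1 <= d 0 i2
          & forall i, i != i1 -> d 0 i2 <= d 0 i]].
Proof.
move=> /symmetric_spectral[P [d [PU AE ->]]] n_gt1.
have le_d_trans : transitive (relpre (d 0) <=%R) by move=> ? ? ? /le_trans; apply.
(* Sorting indices rather than values yields two distinct positions even when the least eigenvalue
   is repeated. *)
rewrite sort_map; set t := sort _ _.
have t_mem i : i \in t by rewrite mem_sort mem_enum.
have t_uniq : uniq t by rewrite sort_uniq enum_uniq.
have t_size : (1 < size t)%N by rewrite size_sort size_enum_ord.
have t_sorted : sorted (relpre (d 0) <=%R) t.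
  by apply: sort_sorted => i j; apply: le_total.
case: t t_mem t_uniq t_size t_sorted => [|i1 [|i2 t]] //= t_mem t_uniq _.
case/andP=> d12 t_sorted; exists P, d, i1, i2; split=> //.
move: t_uniq; rewrite inE negb_or => /andP[/andP[-> _] _]; split=> // i ni1.
have := t_mem i; rewrite !inE (negPf ni1) /= => /predU1P[-> //|it].
by have /allP := order_path_min le_d_trans t_sorted; apply.
Qed.

(** Symmetry of [B] cancels the cross terms, so the form at [z] is the sum of its values at the two
    parts. Recording which part is chosen lets real linear constraints on [z] pass to it. *)
Lemma real_or_imaginary_part (R : rcfType) (n : nat) (B : 'M[R]_n)
    (z : 'rV[R[i]]_n) :
  B^T = B -> z != 0 ->
  0 <= (z *m map_mx (real_complex R) B *m z^t*) 0 0 ->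
  exists x : 'rV[R]_n,
    [/\ x = map_mx (@complex.Re R) z \/ x = map_mx (@complex.Im R) z,
        x != 0 & 0 <= (x *m B *m x^T) 0 0].
Proof.
move=> B_sym z0; set x := map_mx (@complex.Re R) z.
set y := map_mx (@complex.Im R) z.
have formE : (z *m map_mx (real_complex R) B *m z^t*) 0 0 =
    ((x *m B *m x^T) 0 0 + (y *m B *m y^T) 0 0)%:C.
  have zE : z = map_mx (real_complex R) x + 'i *: map_mx (real_complex R) y.
    by apply/rowP => i; rewrite !mxE -complexE.
  have zTE : z^t* = map_mx (real_complex R) x^T - 'i *: map_mx (real_complex R) y^T.
    apply/colP => i; rewrite !mxE; case: (z 0 i) => a b /=.
    by simpc.
  have yx : y *m B *m x^T = x *m B *m y^T.
    have -> : y *m B *m x^T = (x *m B *m y^T)^T.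
      by rewrite !trmx_mul trmxK B_sym mulmxA.
    by apply/matrixP => i j; rewrite !ord1 mxE.
  rewrite zTE {1}zE !mulmxDl !mulmxBr -!scalemxAl -!scalemxAr -!map_mxM yx.
  rewrite scalerA -expr2 sqr_i scaleN1r opprK addrA subrK.
  by rewrite !mxE rmorphD.
rewrite formE ler0c => sum_ge0.
(* A vanishing part cannot be the witness, so these cases are split off first. *)
have [x0|x0] := eqVneq x 0.
  exists y; split; [by right| |by move: sum_ge0; rewrite x0 !mul0mx mxE add0r].
  apply: contraNneq z0 => y0; apply/eqP/rowP => i; rewrite mxE [z 0 i]complexE.
  have /rowP/(_ i) := x0; have /rowP/(_ i) := y0.
  by rewrite !mxE => -> ->; rewrite mulr0 addr0.
have [y0|y0] := eqVneq y 0.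
  by exists x; split; [by left| |by move: sum_ge0; rewrite y0 !mul0mx [X in _ + X]mxE addr0].
have [qx|qx] := leP 0 ((x *m B *m x^T) 0 0); first by exists x; split=> //; left.
exists y; split=> //; first by right.
by apply: le_trans sum_ge0 _; rewrite gerDr ltW.
Qed.

Lemma map_Re_mulmx (R : rcfType) (m n p : nat) (Z : 'M[R[i]]_(m, n))
    (B : 'M[R]_(n, p)) :
  map_mx (@complex.Re R) (Z *m map_mx (real_complex R) B) =
    map_mx (@complex.Re R) Z *m B.
Proof.
apply/matrixP => i j; rewrite !mxE (big_morph _ (id1 := 0) (op1 := +%R)) //=.
  by apply: eq_bigr => k _; rewrite !mxE; case: (Z i k) => a b; simpc.
by move=> [a b] [c d].
Qed.

Lemma map_Im_mulmx (R : rcfType) (m n p : nat) (Z : 'M[R[i]]_(m, n))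
    (B : 'M[R]_(n, p)) :
  map_mx (@complex.Im R) (Z *m map_mx (real_complex R) B) =
    map_mx (@complex.Im R) Z *m B.
Proof.
apply/matrixP => i j; rewrite !mxE (big_morph _ (id1 := 0) (op1 := +%R)) //=.
  by apply: eq_bigr => k _; rewrite !mxE; case: (Z i k) => a b; simpc.
by move=> [a b] [c d].
Qed.

Lemma nz_left_kernel (K : fieldType) (h : 'cV[K]_2) :
  exists2 c : 'rV_2, c != 0 & c *m h = 0.
Proof.
exists (nz_row (kermx h)); last exact/sub_kermxP/nz_row_sub.
rewrite nz_row_eq0 -mxrank_eq0 mxrank_ker -lt0n subn_gt0.
by rewrite (leq_ltn_trans (rank_leq_col _)).
Qed.

(** The rows of [P] form an orthonormal eigenbasis, and [z *m P^t*] lists the coordinates of [z] in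
    it. *)
Lemma shifted_spectral_form (R : rcfType) (n : nat) (A : 'M[R]_n)
    (P : 'M[R[i]]_n) (d : 'rV[R]_n) (s : R) (z : 'rV[R[i]]_n) :
  P \is unitarymx ->
  map_mx (real_complex R) A = P^t* *m diag_mx (map_mx (real_complex R) d) *m P ->
  (z *m map_mx (real_complex R) (A - s%:M) *m z^t*) 0 0 =
    \sum_i (d 0 i - s)%:C * `|(z *m P^t*) 0 i| ^+ 2.
Proof.
move=> PU AE; have PP : P^t* *m P = 1%:M.
  by apply: mulmx1C; apply/unitarymxP.
rewrite map_mxB AE map_scalar_mx; set D := diag_mx _.
have -> : (s%:C)%:M = P^t* *m (s%:C)%:M *m P by rewrite scalar_mxC -mulmxA PP mulmx1.
rewrite -mulmxBl -mulmxBr !mulmxA -mulmxA.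
have -> : P *m z^t* = (z *m P^t*)^t*.
  by rewrite trmx_mul map_mxM /= trmxCK.
rewrite -diag_const_mx -raddfB /= mul_mx_diag mxE; apply: eq_bigr => i _.
by rewrite !mxE -rmorphB /= mulrAC normCK mulrC.
Qed.

(** One half of Courant-Fischer: on the span of the eigenvectors at [i1] and [i2] the form is at
    most the second eigenvalue times the squared norm, and this plane contains a nonzero vector
    orthogonal to [w]. *)
Theorem second_eigenvalue_min (R : rcfType) (n : nat) (A : 'M[R]_n)
    (w : 'rV[R]_n) :
  A^T = A -> (1 < n)%N ->
  exists x : 'rV[R]_n,
    [/\ x != 0, x *m w^T = 0
      & (x *m A *m x^T) 0 0 <= nth 0 (eigenvalues A) 1 * (x *m x^T) 0 0].
Proof.
move=> A_sym n_gt1.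
have [P [d [i1 [i2 [PU AE <- [i12 d12 d2]]]]]] := two_least_eigenvalues A_sym n_gt1.
set s := d 0 i2 in d12 d2 *.
pose f (k : 'I_2) := if k == 0 then i1 else i2.
have f_inj : injective f.
  move=> [[|[|k]] //= lk] [[|[|l]] //= ll].
  - by move=> _; apply/ord_inj.
  - by move/eqP; rewrite /f /= (negPf i12).
  - by move/eqP; rewrite /f /= eq_sym (negPf i12).
  - by move=> _; apply/ord_inj.
(* The column pairs the two eigenvectors with [w]. *)
have [c c0] := nz_left_kernel (rowsub f P *m map_mx (real_complex R) w^T).
set y := c *m rowsub f 1%:M.
have yE i : y 0 i = \sum_k c 0 k * (f k == i)%:R.
  by rewrite mxE; apply: eq_bigr => k _; rewrite !mxE.
have y0 : y != 0.
  apply: contraNneq c0 => /rowP y0; apply/eqP/rowP => k.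
  have := y0 (f k); rewrite yE (bigD1 k) //= eqxx mulr1 mxE big1 ?addr0 => [->|l lk].
    by rewrite mxE.
  by rewrite (inj_eq f_inj) (negPf lk) mulr0.
have -> : rowsub f P = rowsub f 1%:M *m P by rewrite mul_rowsub_mx mul1mx.
rewrite !mulmxA -/y; set z := y *m P => zw.
have zP : z *m P^t* = y by rewrite mulmxtVK.
have z0 : z != 0 by apply: contraNneq y0 => z0; rewrite -zP z0 mul0mx.
have B_sym : (s%:M - A)^T = s%:M - A by rewrite linearB /= tr_scalar_mx A_sym.
have [|x [xE x0 xB]] := real_or_imaginary_part B_sym z0.
  rewrite -opprB map_mxN mulmxN mulNmx mxE (shifted_spectral_form _ _ PU AE) zP.
  rewrite oppr_ge0 -oppr_ge0 -sumrN; apply: sumr_ge0 => i _.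
  rewrite -mulNr -rmorphN opprB.
  (* The coordinates [y] vanish off [i1] and [i2], where the entries of [d] are at most [s]. *)
  have [/existsP[k /eqP <-]|] := boolP [exists k, f k == i].
    by rewrite mulr_ge0 ?exprn_ge0 // ler0c subr_ge0 /f; case: ifP.
  rewrite negb_exists => /forallP nfi.
  by rewrite yE big1 ?normr0 ?expr0n ?mulr0 // => k _; rewrite (negPf (nfi k)) mulr0.
exists x; split=> //.
  by case: xE => ->; rewrite -(map_Re_mulmx, map_Im_mulmx) zw; apply/matrixP=> i j; rewrite !mxE.
move: xB; rewrite mulmxBr mulmxBl mxE [X in _ + X]mxE subr_ge0.
by rewrite mul_mx_scalar -scalemxAl [X in _ <= X -> _]mxE.
Qed.

(** The other half: a plane contains a nonzero vector with no component along the eigenvector at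
    [i1], and all other eigenvalues are at least the second. *)
Theorem second_eigenvalue_max (R : rcfType) (n : nat) (A : 'M[R]_n)
    (X : 'M[R]_(2, n)) :
  A^T = A -> (1 < n)%N -> row_free X ->
  exists x : 'rV[R]_n,
    [/\ x != 0, (x <= X)%MS
      & nth 0 (eigenvalues A) 1 * (x *m x^T) 0 0 <= (x *m A *m x^T) 0 0].
Proof.
move=> A_sym n_gt1 X_free.
have [P [d [i1 [i2 [PU AE <- [i12 d12 d2]]]]]] := two_least_eigenvalues A_sym n_gt1.
set s := d 0 i2 in d12 d2 *.
have [c c0] := nz_left_kernel (col i1 (map_mx (real_complex R) X *m P^t*)).
rewrite colE !mulmxA -colE; set z := c *m map_mx _ X => zP.
have z0 : z != 0.
  by rewrite mulmx_free_eq0 ?c0 // row_free_map.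
have B_sym : (A - s%:M)^T = A - s%:M by rewrite linearB /= tr_scalar_mx A_sym.
have [|x [xE x0 xB]] := real_or_imaginary_part B_sym z0.
  rewrite (shifted_spectral_form _ _ PU AE); apply: sumr_ge0 => i _.
  have [->|ni1] := eqVneq i i1.
    by have /matrixP/(_ 0 0) := zP; rewrite !mxE => ->; rewrite normr0 expr0n mulr0.
  by rewrite mulr_ge0 ?exprn_ge0 // ler0c subr_ge0 d2.
exists x; split=> //.
  by case: xE => ->; rewrite (map_Re_mulmx, map_Im_mulmx) submxMl.
move: xB; rewrite mulmxBr mulmxBl mxE [X in _ + X]mxE subr_ge0.
by rewrite mul_mx_scalar -scalemxAl [X in X <= _ -> _]mxE.
Qed.

End SymmetricMatrices.

(** Multiplying a linear dependence by [u^T], then by [v^T], isolates each coefficient. *)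
Lemma orthogonal_row_free (F : fieldType) (n : nat) (u v : 'rV[F]_n) :
  (u *m u^T) 0 0 != 0 -> (v *m v^T) 0 0 != 0 -> v *m u^T = 0 ->
  row_free (col_mx u v).
Proof.
move=> uu vv vu; have uv : u *m v^T = 0 by rewrite -[LHS]trmxK trmx_mul trmxK vu trmx0.
rewrite -kermx_eq0; apply/rowV0P => c /sub_kermxP.
rewrite -[c]hsubmxK mul_row_col => /[dup] /(congr1 (mulmx^~ u^T)).
rewrite mulmxDl mul0mx -!mulmxA vu mulmx0 addr0 => cu.
move=> /(congr1 (mulmx^~ v^T)); rewrite mulmxDl mul0mx -!mulmxA uv mulmx0 add0r => cv.
have cancel11 (a b : 'M[F]_1) : b 0 0 != 0 -> a *m b = 0 -> a = 0.
  move=> b0 /matrixP/(_ 0 0); rewrite !mxE big_ord1 => /eqP.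
  rewrite mulf_eq0 (negPf b0) orbF => /eqP a0.
  by apply/matrixP => i j; rewrite !ord1 a0 mxE.
by rewrite (cancel11 _ _ uu cu) (cancel11 _ _ vv cv) row_mx0.
Qed.

(** * The variational characterization of lambda_2 *)

Section Graph.
Variables (R : rcfType) (T : finType) (e : rel T).
Implicit Types f g : T -> R.

Definition energy f : R := 2^-1 * \sum_x \sum_(y | e x y) (f x - f y) ^+ 2.

Definition wdot f g : R := \sum_x (deg e x)%:R * (f x * g x).

Lemma sum_deg (h : T -> R) :
  \sum_x (deg e x)%:R * h x = \sum_x \sum_(y | e x y) h x.
Proof.
by apply: eq_bigr => x _; rewrite sumr_const mulr_natl /deg cardsE.
Qed.

Lemma energy_ge0 f : 0 <= energy f.
Proof.
rewrite mulr_ge0 ?invr_ge0 ?ler0n //.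
by do 2![apply: sumr_ge0 => ? _]; apply: sqr_ge0.
Qed.

Hypothesis e_sym : symmetric e.

Lemma energyE f :
  energy f = wdot f f - \sum_x \sum_(y | e x y) f x * f y.
Proof.
have swap : \sum_x \sum_(y | e x y) f y * f y = \sum_x \sum_(y | e x y) f x * f x.
  rewrite (exchange_big_dep xpredT) //=.
  by apply: eq_bigr => x _; apply: eq_bigl => y; rewrite e_sym.
rewrite /energy /wdot (sum_deg (fun x => f x * f x)).
have -> : \sum_x \sum_(y | e x y) (f x - f y) ^+ 2 =
    \sum_x \sum_(y | e x y) f x * f x + \sum_x \sum_(y | e x y) f y * f y
    - 2 * \sum_x \sum_(y | e x y) f x * f y.
  rewrite mulr_sumr -big_split -sumrB; apply: eq_bigr => x _.
  rewrite mulr_sumr -big_split -sumrB; apply: eq_bigr => y _ /=; ring.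
by rewrite swap; field.
Qed.

Hypothesis deg_gt0 : forall x, (0 < deg e x)%N.

Lemma wdot_gt0 f : (exists x, f x != 0) -> 0 < wdot f f.
Proof.
case=> x fx; rewrite /wdot (bigD1 x) //= ltr_wpDr //.
  by apply: sumr_ge0 => y _; rewrite mulr_ge0 ?ler0n // -expr2 sqr_ge0.
by rewrite mulr_gt0 ?ltr0n // -expr2 exprn_even_gt0 //= fx.
Qed.

(* [D^(1/2) f], which turns the weighted inner product into the standard one. *)
Definition weighted_row f : 'rV[R]_#|T| :=
  \row_i (Num.sqrt (deg e (enum_val i))%:R * f (enum_val i)).

Lemma sqrt_deg_neq0 x : Num.sqrt (deg e x)%:R != 0 :> R.
Proof. by rewrite gt_eqF // sqrtr_gt0 ltr0n. Qed.

Lemma weighted_row_surj (x : 'rV[R]_#|T|) : exists f, x = weighted_row f.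
Proof.
exists (fun a => (Num.sqrt (deg e a)%:R)^-1 * x 0 (enum_rank a)).
by apply/rowP => i; rewrite mxE mulVKf ?sqrt_deg_neq0 // enum_valK.
Qed.

Lemma weighted_row_neq0 f : (exists x, f x != 0) <-> weighted_row f != 0.
Proof.
split=> [[x fx]|].
  apply: contraNneq fx => /rowP/(_ (enum_rank x))/eqP.
  by rewrite !mxE enum_rankK mulf_eq0 (negPf (sqrt_deg_neq0 _)).
case/rV0Pn => i; rewrite mxE mulf_eq0 (negPf (sqrt_deg_neq0 _)) => fi.
by exists (enum_val i).
Qed.

Lemma weighted_row_dot f g :
  (weighted_row f *m (weighted_row g)^T) 0 0 = wdot f g.
Proof.
rewrite mxE /wdot [RHS](reindex _ (onW_bij _ (enum_val_bij T))) /=.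
apply: eq_bigr => i _; rewrite !mxE mulrACA -expr2 sqr_sqrtr ?ler0n //.
Qed.

Lemma normalized_lapl_mx_sym :
  (normalized_lapl_mx R e)^T = normalized_lapl_mx R e.
Proof.
rewrite /normalized_lapl_mx !trmx_mul !tr_diag_mx mulmxA; congr (_ *m _ *m _).
rewrite linearB /= tr_diag_mx; congr (_ - _).
by apply/matrixP => i j; rewrite !mxE e_sym.
Qed.

(** The weights cancel [deg_isqrt_mx], leaving the form of [D - A], which [energyE] identifies. *)
Lemma weighted_row_energy f :
  (weighted_row f *m normalized_lapl_mx R e *m (weighted_row f)^T) 0 0 = energy f.
Proof.
pose r := \row_i f (enum_val i) : 'rV[R]_#|T|.
have rE : weighted_row f *m deg_isqrt_mx R e = r.
  by apply/rowP => i; rewrite mul_mx_diag !mxE mulrAC mulfV ?mul1r ?sqrt_deg_neq0.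
have -> : weighted_row f *m normalized_lapl_mx R e *m (weighted_row f)^T =
    r *m lapl_mx R e *m r^T.
  by rewrite -rE trmx_mul tr_diag_mx !mulmxA.
rewrite mulmxBr mulmxBl mxE [X in _ + X]mxE energyE; congr (_ - _).
  rewrite mul_mx_diag mxE /wdot [RHS](reindex _ (onW_bij _ (enum_val_bij T))) /=.
  by apply: eq_bigr => i _; rewrite !mxE mulrCA mulrA.
rewrite mxE [RHS](reindex _ (onW_bij _ (enum_val_bij T))) /=.
apply: eq_bigr => j _; rewrite !mxE mulr_suml [RHS]big_mkcond.
rewrite [RHS](reindex _ (onW_bij _ (enum_val_bij T))) /=.
apply: eq_bigr => i _; rewrite !mxE e_sym.
by case: (e _ _); rewrite ?mulr1 ?mulr0 ?mul0r // mulrC.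
Qed.

Lemma energy_affine (a b : R) f :
  energy (fun x => a + b * f x) = b ^+ 2 * energy f.
Proof.
rewrite /energy [RHS]mulrCA [b ^+ 2 * _]mulr_sumr; congr (_ * _); apply: eq_bigr => x _.
by rewrite mulr_sumr; apply: eq_bigr => y _; ring.
Qed.

Lemma lambda2_min :
  (1 < #|T|)%N ->
  exists f, [/\ exists x, f x != 0, wdot f (fun=> 1) = 0
              & energy f <= lambda R e 2 * wdot f f].
Proof.
move=> T_gt1.
have [x [x0 xw]] := second_eigenvalue_min (weighted_row (fun=> 1))
  normalized_lapl_mx_sym T_gt1.
have [f fE] := weighted_row_surj x.
rewrite fE weighted_row_energy weighted_row_dot => fle.
exists f; split=> //; first by apply/weighted_row_neq0; rewrite -fE.
by rewrite -weighted_row_dot -fE xw mxE.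
Qed.

(** Apply the plane bound to the span of the constant 1 and [f]: a constant component adds to the
    norm but not to the energy. *)
Lemma lambda2_max f :
  (1 < #|T|)%N -> wdot f (fun=> 1) = 0 ->
  lambda R e 2 * wdot f f <= energy f.
Proof.
move=> T_gt1 f1.
(* The zero function would not span a plane with the constants. *)
have [/existsP f0|] := boolP [exists x, f x != 0]; last first.
  rewrite negb_exists => /forallP f0.
  rewrite [wdot f f]big1 ?mulr0 ?energy_ge0 // => x _.
  by have := f0 x; rewrite negbK => /eqP ->; rewrite !mulr0.
have one0 : exists x : T, 1 != 0 :> R.
  by case: f0 => x _; exists x; exact: oner_neq0.
have ff := wdot_gt0 f0; have oo := wdot_gt0 one0.
set X := col_mx (weighted_row (fun=> 1)) (weighted_row f).
have [|x [x0 xX]] := second_eigenvalue_max normalized_lapl_mx_sym T_gt1 (X := X).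
  apply: orthogonal_row_free; rewrite ?weighted_row_dot ?gt_eqF //.
  by apply/matrixP => i j; rewrite !ord1 weighted_row_dot f1 mxE.
have [a [b xE]] : exists a b, x = weighted_row (fun y => a + b * f y).
  (* Reading 2 as [1 + 1] splits the coefficient row into [a] and [b]. *)
  case/(@submxP _ 1 (1 + 1)): xX => c ->; rewrite /X -[c](@hsubmxK _ 1 1 1) mul_row_col.
  move: (lsubmx c) (rsubmx c) => a b; exists (a 0 ord0), (b 0 ord0); apply/rowP => i.
  rewrite !mxE !big_ord1 ![weighted_row _ _ _]mxE; ring.
move: x0; rewrite xE weighted_row_energy weighted_row_dot energy_affine => x0.
have -> : wdot (fun y => a + b * f y) (fun y => a + b * f y) =
    a ^+ 2 * wdot (fun=> 1) (fun=> 1) + b ^+ 2 * wdot f f.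
  transitivity (a ^+ 2 * wdot (fun=> 1) (fun=> 1) + b ^+ 2 * wdot f f
                + 2 * a * b * wdot f (fun=> 1)); last by rewrite f1 mulr0 addr0.
  rewrite /wdot !mulr_sumr -!big_split; apply: eq_bigr => y _ /=; ring.
move=> le_ab; have E0 := energy_ge0 f.
(* A positive [lambda R e 2] rules out [b = 0], since a nonzero constant has zero energy and
   positive norm. *)
have [l0|l0] := leP (lambda R e 2) 0.
  by apply: le_trans E0; rewrite mulr_le0_ge0 // ltW.
have [b0|b0] := eqVneq b 0.
  have a0 : a != 0.
    by case/weighted_row_neq0: x0 => y; rewrite b0 mul0r addr0.
  move: le_ab; rewrite b0 expr0n !mul0r addr0 leNgt mulr_gt0 //.
  by rewrite mulr_gt0 // exprn_even_gt0.
have b2 : 0 < b ^+ 2 by rewrite exprn_even_gt0.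
rewrite -(ler_pM2l b2); apply: le_trans le_ab.
by rewrite mulrCA ler_pM2l // lerDr mulr_ge0 ?sqr_ge0 // ltW.
Qed.

End Graph.

(** Zero energy makes [f] constant along edges, hence constant by connectivity, and orthogonality to
    [De] then forces [f = 0]. *)
Lemma energy_gt0 (R : rcfType) (T : finType) (e : rel T) (f : T -> R) :
  connected_graph e -> (forall x, (0 < deg e x)%N) ->
  (exists x, f x != 0) -> wdot e f (fun=> 1) = 0 -> 0 < energy e f.
Proof.
move=> e_conn deg_gt0 [x fx] f1; rewrite lt_def energy_ge0 andbT.
apply: contra_neq fx; rewrite /energy => /eqP.
rewrite mulf_eq0 invr_eq0 pnatr_eq0 /= psumr_eq0 => [/allP E0|a _]; last first.
  by apply: sumr_ge0 => b _; apply: sqr_ge0.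
have f_edge a b : e a b -> f a = f b.
  move=> ab; have := E0 a (mem_index_enum a).
  rewrite /= psumr_eq0 => [/allP/(_ b (mem_index_enum b))|c _]; last exact: sqr_ge0.
  by rewrite ab /= sqrf_eq0 subr_eq0 => /eqP.
have f_const y : f y = f x.
  have /connectP[p xp ->] := e_conn x y; elim: p x xp {f1 y} => //= a p IHp b.
  by case/andP=> /f_edge -> /IHp.
have vol_gt0 : 0 < wdot e (fun=> 1 : R) (fun=> 1).
  by apply: wdot_gt0 => //; exists x; exact: oner_neq0.
have : f x * wdot e (fun=> 1) (fun=> 1) = 0.
  rewrite -[RHS]f1 mulr_sumr; apply: eq_bigr => y _; rewrite f_const; ring.
by move/eqP; rewrite mulf_eq0 (gt_eqF vol_gt0) orbF => /eqP.
Qed.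

(** * Edge subdivision *)

Lemma big_option (V : nmodType) (T : finType) (F : option T -> V) :
  \sum_x F x = F None + \sum_a F (Some a).
Proof.
rewrite (bigD1 None) //=; congr (_ + _).
by rewrite (reindex_omap Some id) => [|[]] //=; apply: eq_bigl => a; rewrite eqxx.
Qed.

Lemma connected_deg_gt0 (T : finType) (e : rel T) (x y : T) :
  connect e x y -> x != y -> (0 < deg e x)%N.
Proof.
case/connectP => [[|z p]] /= => [_ -> /eqP //|/andP[xz _] _ _].
by apply/card_gt0P; exists z; rewrite inE.
Qed.

Section Subdivision.
Variables (R : rcfType) (T : finType) (e : rel T) (u v : T).
Hypotheses (e_sym : symmetric e) (e_irr : irreflexive e) (uv_edge : e u v).

Let uv_neq : u != v.
Proof. by apply: contraTneq uv_edge => ->; rewrite e_irr. Qed.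

Lemma subdivide_some (a b : T) :
  subdivide e u v (Some a) (Some b) =
    e a b && ~~ ((a == u) && (b == v) || (a == v) && (b == u)).
Proof.
rewrite /=; have [ab|//] := boolP (e a b); rewrite /=; congr (~~ _).
apply/eqP/orP => [abuv|[|]/andP[/eqP-> /eqP->]] //; last by rewrite setUC.
have ab_neq : a != b by apply: contraTneq ab => ->; rewrite e_irr.
have : a \in [set u; v] by rewrite -abuv !inE eqxx.
have : b \in [set u; v] by rewrite -abuv !inE eqxx orbT.
rewrite !inE => /orP[]/eqP bE /orP[]/eqP aE; move: ab_neq;
  rewrite aE bE ?eqxx //; by [left|right].
Qed.

(** Ordered pairs are summed: [uv] is lost, and each new edge gained, in both orientations. *)
Lemma sum_subdivide (F : option T -> option T -> R) :
  \sum_x \sum_(y | subdivide e u v x y) F x y =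
    \sum_a \sum_(b | e a b) F (Some a) (Some b)
    - F (Some u) (Some v) - F (Some v) (Some u)
    + F None (Some u) + F None (Some v) + F (Some u) None + F (Some v) None.
Proof.
have sum_uv (h : T -> R) : \sum_(a | a \in [set u; v]) h a = h u + h v.
  by rewrite big_setU1 ?big_set1 // inE.
have sum_none : \sum_(y | subdivide e u v None y) F None y =
    F None (Some u) + F None (Some v).
  by rewrite big_mkcond big_option /= add0r -big_mkcond (sum_uv (fun a => F None (Some a))).
have sum_some a : \sum_(y | subdivide e u v (Some a) y) F (Some a) y =
    \sum_(b | e a b) F (Some a) (Some b)
    - (if a == u then F (Some u) (Some v) else 0)
    - (if a == v then F (Some v) (Some u) else 0)
    + (if a \in [set u; v] then F (Some a) None else 0).
  rewrite big_mkcond big_option addrC; congr (_ + _).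
  (* Writing the corrections as sums over [b] allows a termwise comparison. *)
  have pick_one c w (h : T -> R) : \sum_b (if c && (b == w) then h b else 0) =
      if c then h w else 0.
    by case: c => /=; [rewrite -big_mkcond big_pred1_eq | rewrite big1].
  rewrite -(pick_one _ v (fun b => F (Some u) (Some b))).
  rewrite -(pick_one _ u (fun b => F (Some v) (Some b))).
  rewrite [X in X - _ - _]big_mkcond -!sumrB; apply: eq_bigr => b _.
  rewrite subdivide_some.
  have [->|au] := eqVneq a u; have [->|bv] := eqVneq b v;
    rewrite ?(negPf uv_neq) ?[v == u]eq_sym ?(negPf uv_neq) ?uv_edge /=
      ?andbF ?andbT ?subr0 ?subrr //.
  have [->|av] := eqVneq a v; have [->|bu] := eqVneq b u;
    by rewrite ?[e v u]e_sym ?uv_edge /= ?andbT ?subr0 ?subrr.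
rewrite big_option sum_none (eq_bigr _ (fun a _ => sum_some a)).
rewrite big_split !sumrB /= -!big_mkcond /=.
have /= -> := sum_uv (fun a => F (Some a) None); rewrite !big_pred1_eq; ring.
Qed.

(** Old degrees are unchanged, as [w] replaces the lost neighbour of [u] and of [v]; [w] itself has
    degree 2. *)
Lemma sum_deg_subdivide (h : option T -> R) :
  \sum_x (deg (subdivide e u v) x)%:R * h x =
    \sum_a (deg e a)%:R * h (Some a) + 2 * h None.
Proof.
by rewrite sum_deg (sum_subdivide (fun x _ => h x)) -(sum_deg e (fun a => h (Some a))); ring.
Qed.

(** With a = f(u) and b = f(v), this is (t - a)^2 + (t - b)^2 - (a - b)^2 = 2(t - a)(t - b). *)
Lemma energy_subdivide (f : T -> R) (t : R) :
  energy (subdivide e u v) (oapp f t) = energy e f + 2 * (t - f u) * (t - f v).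
Proof.
rewrite /energy (sum_subdivide (fun x y => (oapp f t x - oapp f t y) ^+ 2)) /=.
by field.
Qed.

Lemma deg_subdivide_gt0 :
  (forall a, (0 < deg e a)%N) -> forall x, (0 < deg (subdivide e u v) x)%N.
Proof.
move=> deg_gt0 [a|]; apply/card_gt0P; last by exists (Some u); rewrite inE /= !inE eqxx.
have [auv|auv] := boolP (a \in [set u; v]); first by exists None; rewrite inE.
have /card_gt0P[b] := deg_gt0 a; rewrite inE => ab.
exists (Some b); rewrite inE subdivide_some ab; move: auv; rewrite !inE.
by case: (a == u); case: (a == v).
Qed.

(** The extension of [f] by [t] has weighted sum [2 * t] over total degree [vol + 2], so its mean is
    [c]. Centering preserves the energy and lowers the weighted norm by the quotient subtracted
    here. *)
Lemma lambda2_subdivide (f : T -> R) (t : R) :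
  (forall a, (0 < deg e a)%N) -> wdot e f (fun=> 1) = 0 ->
  lambda R (subdivide e u v) 2 *
      (wdot e f f + 2 * t ^+ 2 - (2 * t) ^+ 2 / (\sum_a (deg e a)%:R + 2)) <=
    energy e f + 2 * (t - f u) * (t - f v).
Proof.
move=> deg_gt0 f1; set vol := \sum_a _; set c := 2 * t / (vol + 2).
have vol_ge0 : 0 <= vol by apply: sumr_ge0 => a _; apply: ler0n.
have vol2 : vol + 2 != 0 by rewrite gt_eqF // ltr_wpDl.
pose e' := subdivide e u v.
(* The factor 1 gives [g] the shape expected by [energy_affine]. *)
pose g x := - c + 1 * oapp f t x.
have f1' : \sum_a (deg e a)%:R * f a = 0.
  by rewrite -[RHS]f1; apply: eq_bigr => a _; rewrite mulr1.
have g1 : wdot e' g (fun=> 1) = 0.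
  rewrite /wdot sum_deg_subdivide.
  have -> : \sum_a (deg e a)%:R * (g (Some a) * 1) =
      \sum_a (deg e a)%:R * f a - c * vol.
    rewrite mulr_sumr -sumrB; apply: eq_bigr => a _; rewrite /g /=; ring.
  by rewrite f1' /g /= /c; field.
have gg : wdot e' g g = wdot e f f + 2 * t ^+ 2 - (2 * t) ^+ 2 / (vol + 2).
  rewrite [wdot e' g g]/wdot sum_deg_subdivide.
  have -> : \sum_a (deg e a)%:R * (g (Some a) * g (Some a)) =
      wdot e f f - 2 * c * (\sum_a (deg e a)%:R * f a) + c ^+ 2 * vol.
    rewrite /wdot /vol !mulr_sumr -sumrB -big_split; apply: eq_bigr => a _.
    rewrite /g /=; ring.
  by rewrite f1' /g /= /c; field.
have T_gt1 : (1 < #|{: option T}|)%N.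
  by rewrite card_option ltnS; apply/card_gt0P; exists u.
have := lambda2_max (subdivide_sym u v e_sym) (deg_subdivide_gt0 deg_gt0) T_gt1 g1.
by rewrite gg energy_affine expr1n mul1r energy_subdivide.
Qed.

End Subdivision.

(* The test value is [t = 0] when [a] and [b] have opposite signs, so that
   [(t - a) (t - b) = a b <= 0] with unchanged norm, and [t = a] otherwise, so
   that the energy is unchanged and the norm grows. *)
Lemma rayleigh_bound_optimize (F : realFieldType) (l l' E N vol a b : F) :
  0 < N -> 0 < vol -> 0 <= E -> E <= l * N ->
  (forall t, l' * (N + 2 * t ^+ 2 - (2 * t) ^+ 2 / (vol + 2)) <=
             E + 2 * (t - a) * (t - b)) ->
  l' <= l /\ (0 < E -> a * b != 0 -> l' < l).
Proof.
move=> N_gt0 vol_gt0 E_ge0 El bound.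
have [ab|ab] := leP (a * b) 0.
  have le0 : l' * N <= l * N + 2 * (a * b).
    have := bound 0; rewrite mulr0 expr0n /= mul0r mulr0 addr0 subr0; lra.
  split=> [|_ ab0]; first by rewrite -(ler_pM2r N_gt0); lra.
  have ab_lt0 : a * b < 0 by rewrite lt_neqAle ab0.
  by rewrite -(ltr_pM2r N_gt0); lra.
(* [K] is the net growth of the norm at [t = a]: 2a^2 - 4a^2/(vol + 2). *)
set K := 2 * a ^+ 2 * vol / (vol + 2).
have a0 : a != 0 by apply: contraTneq ab => ->; rewrite mul0r ltxx.
have K_gt0 : 0 < K.
  have a2 : 0 < a ^+ 2 by rewrite exprn_even_gt0.
  by rewrite divr_gt0 ?addr_gt0 ?ltr0n // mulr_gt0 // mulr_gt0 ?ltr0n.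
have le_a : l' * (N + K) <= E.
  have := bound a; rewrite subrr mulr0 mul0r addr0.
  suff -> : N + 2 * a ^+ 2 - (2 * a) ^+ 2 / (vol + 2) = N + K by [].
  by rewrite /K; field; rewrite gt_eqF // addr_gt0 ?ltr0n.
have l_ge0 : 0 <= l.
  by rewrite -(pmulr_lge0 _ N_gt0) (le_trans E_ge0).
have NK_gt0 : 0 < N + K by rewrite addr_gt0.
(* Both claims follow from l'(N + K) <= E <= lN <= l(N + K); the last step is strict once l > 0. *)
split=> [|E_gt0 _].
  rewrite -(ler_pM2r NK_gt0); have := mulr_ge0 l_ge0 (ltW K_gt0); lra.
have l_gt0 : 0 < l by rewrite -(pmulr_lgt0 _ N_gt0) (lt_le_trans E_gt0).
rewrite -(ltr_pM2r NK_gt0); have := mulr_gt0 l_gt0 K_gt0; lra.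
Qed.

Theorem theorem3p1 (R : realType) (n : nat) (T : finType) (e : rel T) (u v : T)
    (e_sym : symmetric e) (e_irr : irreflexive e) (e_conn : connected_graph e)
    (T_order : #|T| = n) (uv_edge : e u v) :
  lambda R (subdivide e u v) 2 <= lambda R e 2 /\
  (forall f : T -> R, harmonic_eigenfunction e f -> f u * f v != 0 ->
     lambda R (subdivide e u v) 2 < lambda R e 2).
Proof.
have uv : u != v by apply: contraTneq uv_edge => ->; rewrite e_irr.
(* Each vertex is joined by a path to a different one: [u] to [v], and any other vertex to [u]. *)
have deg_gt0 x : (0 < deg e x)%N.
  have [->|xu] := eqVneq x u; first exact: connected_deg_gt0 (e_conn u v) uv.
  exact: connected_deg_gt0 (e_conn x u) xu.
have T_gt1 : (1 < #|T|)%N.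
  by rewrite (cardD1 u) (cardD1 v) !inE eq_sym uv.
set vol : R := \sum_a (deg e a)%:R.
have vol_gt0 : 0 < vol.
  rewrite /vol (bigD1 u) //= ltr_wpDr ?ltr0n //.
  by apply: sumr_ge0 => a _; apply: ler0n.
split=> [|f [f0 f1 fR] fuv].
  have [f [f0 f1 fl]] := lambda2_min R e_sym deg_gt0 T_gt1.
  have bound t := lambda2_subdivide e_sym e_irr uv_edge t deg_gt0 f1.
  by case: (rayleigh_bound_optimize (wdot_gt0 deg_gt0 f0) vol_gt0
              (energy_ge0 e f) fl bound).
have {}f1 : wdot e f (fun=> 1) = 0.
  by rewrite -[RHS]f1; apply: eq_bigr => a _; rewrite mulr1.
have N_gt0 := wdot_gt0 deg_gt0 f0.
(* For a harmonic eigenfunction this bound is in fact an equality. *)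
have fl : energy e f <= lambda R e 2 * wdot e f f.
  rewrite -fR /rayleigh -/(energy e f).
  have <- : wdot e f f = \sum_x (deg e x)%:R * f x ^+ 2 by [].
  by rewrite divfK ?gt_eqF.
have bound t := lambda2_subdivide e_sym e_irr uv_edge t deg_gt0 f1.
have [_] := rayleigh_bound_optimize N_gt0 vol_gt0 (energy_ge0 e f) fl bound.
(* Strictness rests on positive energy, supplied by connectivity. *)
by apply=> //; apply: energy_gt0.
Qed.
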